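(* Let $\mathcal{A}$ be a finite direct factor set with the property that every subalgebra of an algebra in $\mathcal{A}$ is (isomorphic to) a product of algebras in $\mathcal{A}$. Then every finite algebra in the variety generated by $\mathcal{A}$ has uniform congruences.
   Context: A subdirect product $\mathfrak{B}$ of $\mathfrak{A}_1,\dots,\mathfrak{A}_n$ is irreducible iff for every proper subset of the coordinate projections, the intersection of their kernels on $\mathfrak{B}$ is strictly larger than the identity congruence. A set $\mathcal{A}$ of finite algebras (of the same type) is a direct factor set iff whenever $\mathfrak{B}$ is an irreducible subdirect product of algebras $\mathfrak{A}_1,\dots,\mathfrak{A}_n$ from $\mathcal{A}$, then $\mathfrak{B}=\mathfrak{A}_1\times\dots\times\mathfrak{A}_n$. A congruence is uniform iff all its classes have the same cardinality; an algebra has uniform congruences iff all its congruences are uniform. *)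

(* Defs.v *)
From mathcomp Require Import all_boot.
From mathcomp Require Import boolp classical_sets functions cardinality.

Set Implicit Arguments.
Unset Strict Implicit.
Unset Printing Implicit Defensive.

Local Open Scope classical_set_scope.
Local Open Scope card_scope.

Record signature : Type := Signature {
  symbol : Type;
  arity : symbol -> nat
}.

(* Following the usual convention of universal algebra, carriers are nonempty. *)
Record algebra (S : signature) : Type := Algebra {
  carrier :> Type;
  op : forall s : symbol S, ('I_(arity s) -> carrier) -> carrier;
  algebra_inhabited : inhabited carrier
}.

Definition finite_algebra (S : signature) (A : algebra S) : Prop :=
  finite_set [set: A].

Definition hom (S : signature) (A B : algebra S) (f : A -> B) : Prop :=
  forall (s : symbol S) (x : 'I_(arity s) -> A),
    f (op x) = op (fun i => f (x i)).

Definition isomorphic (S : signature) (A B : algebra S) : Prop :=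
  exists f : A -> B, hom f /\ bijective f.

Definition subuniverse (S : signature) (A : algebra S) (B : set A) : Prop :=
  B !=set0 /\
  forall (s : symbol S) (x : 'I_(arity s) -> A),
    (forall i, B (x i)) -> B (op x).

Section Subalgebra.
Variables (S : signature) (A : algebra S) (B : set A) (subB : subuniverse B).

Lemma sub_op_subproof (s : symbol S) (x : 'I_(arity s) -> {a : A | B a}) :
  B (op (fun i => proj1_sig (x i))).
Proof. by apply: (proj2 subB) => i; exact: proj2_sig. Qed.

Lemma sub_inhabited_subproof : inhabited {a : A | B a}.
Proof. by case: (proj1 subB) => x Bx; exact: inhabits (exist _ x Bx). Qed.

Definition subalgebra : algebra S :=
  @Algebra S {a : A | B a}
    (fun s x => exist B (op (fun i => proj1_sig (x i))) (sub_op_subproof x))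
    sub_inhabited_subproof.
End Subalgebra.

Section Product.
Variables (S : signature) (I : Type) (F : I -> algebra S).

Lemma prod_inhabited_subproof : inhabited (forall i, F i).
Proof.
have ex i : exists x : F i, True by case: (algebra_inhabited (F i)) => x; exists x.
exact: inhabits (fun i => projT1 (cid (ex i))).
Qed.

Definition product : algebra S :=
  @Algebra S (forall i, F i)
    (fun s x => fun i => op (fun j => x j i))
    prod_inhabited_subproof.
End Product.

(* Classes of algebras are plain predicates, since [set (algebra S)] would put
   the universe of [set] strictly above that of carriers, whereas ['I_n] forces
   the converse. Finiteness is thus an explicit enumeration. *)
Definition class (S : signature) : Type := algebra S -> Prop.

Definition finite_class (S : signature) (K : class S) : Prop :=
  exists (m : nat) (G : 'I_m -> algebra S),
    forall A : algebra S, K A <-> exists i, A = G i.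

Record variety (S : signature) (V : class S) : Prop := Variety {
  variety_H : forall (A B : algebra S) (f : A -> B),
    hom f -> range f = [set: B] -> V A -> V B;
  variety_S : forall (A : algebra S) (B : set A) (subB : subuniverse B),
    V A -> V (subalgebra subB);
  variety_P : forall (I : Type) (F : I -> algebra S),
    (forall i, V (F i)) -> V (product F)
}.

Definition generated_variety (S : signature) (K : class S) : class S :=
  fun B => forall V : class S, variety V -> (forall A, K A -> V A) -> V B.

Record congruence (S : signature) (A : algebra S) (theta : A -> A -> Prop) :
    Prop := Congruence {
  congruence_refl : forall x, theta x x;
  congruence_sym : forall x y, theta x y -> theta y x;
  congruence_trans : forall x y z, theta x y -> theta y z -> theta x z;
  congruence_op : forall (s : symbol S) (x y : 'I_(arity s) -> A),
    (forall i, theta (x i) (y i)) -> theta (op x) (op y)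
}.

Definition uniform (S : signature) (A : algebra S) (theta : A -> A -> Prop) :
    Prop :=
  forall x y : A, [set z | theta x z] #= [set z | theta y z].

Definition has_uniform_congruences (S : signature) (A : algebra S) : Prop :=
  forall theta : A -> A -> Prop, congruence theta -> uniform theta.

Section Subdirect.
Variables (S : signature) (n : nat) (F : 'I_n -> algebra S).

Definition subdirect (B : set (product F)) : Prop :=
  subuniverse B /\ forall (i : 'I_n), [set x i | x in B] = [set: F i].

Definition identity_on (B : set (product F)) : set (product F * product F) :=
  [set p | [/\ B p.1, B p.2 & p.1 = p.2]].

(* Intersection of the kernels on B of the projections indexed by J; for empty
   J this is the full relation on B. *)
Definition proj_kernels_on (B : set (product F)) (J : set 'I_n) :
    set (product F * product F) :=
  [set p | [/\ B p.1, B p.2 & forall i, J i -> p.1 i = p.2 i]].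

(* Projections are counted by index, so two coordinates on which the
   projections agree still count as distinct. *)
Definition irreducible (B : set (product F)) : Prop :=
  forall J : set 'I_n, J `<` [set: 'I_n] ->
    identity_on B `<` proj_kernels_on B J.
End Subdirect.

Definition direct_factor_set (S : signature) (K : class S) : Prop :=
  (forall A, K A -> finite_algebra A) /\
  forall (n : nat) (F : 'I_n -> algebra S), (forall i, K (F i)) ->
    forall B : set (product F),
      subdirect B -> irreducible B -> B = [set: product F].

(* The factors may repeat, and the empty product (a one-element algebra) is
   allowed. *)
Definition is_product_of (S : signature) (K : class S) (A : algebra S) : Prop :=
  exists (n : nat) (F : 'I_n -> algebra S),
    (forall i, K (F i)) /\ isomorphic A (product F).

(* Main.v *)
Require Import Defs.
From mathcomp Require Import all_boot.
From mathcomp Require Import cyclic.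
From mathcomp Require Import boolp classical_sets functions cardinality.

(** Let B be a finite algebra in the variety generated by K. Mapping the
    relatively free algebra on the set B onto B exhibits B as a quotient of a
    subalgebra D of a finite product of members of K. Every such subalgebra is
    isomorphic to a product of members of K: replace the factors by the images
    of the projections, split these into members of K, and drop coordinates
    until the subdirect representation is irreducible.

    If phi is a congruence of D and [x] denotes the phi-class of x, the tuples
    (x, y_1, ..., y_m) with all y_i in [x] form a subalgebra of a power of D,
    with sum_x |[x]|^m elements. Hence only the finitely many primes dividing
    the cardinalities of members of K divide any of these power sums, which
    forces all |[x]| to be equal. Uniformity passes to the quotient B by
    counting fibres. *)

Set Implicit Arguments.
Unset Strict Implicit.
Unset Printing Implicit Defensive.

(** * Prime divisors of power sums *)

Lemma expn_mod_prime_power (p r d m : nat) : prime p -> 0 < r -> r <= m ->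
  totient (p ^ r) %| m -> d ^ m = ~~ (p %| d) %[mod p ^ r].
Proof.
move=> pp r0 rm /dvdnP[k mk].
have [pd|npd] := boolP (p %| d).
  rewrite mod0n; apply/eqP; rewrite -/(dvdn _ _).
  exact: dvdn_trans (dvdn_exp2l p rm) (dvdn_exp2r m pd).
have cop : coprime d (p ^ r).
  by rewrite coprime_sym coprime_pexpl // prime_coprime.
by rewrite mk mulnC expnM -modnXm Euler_exp_totient // modnXm exp1n.
Qed.

(** Modulo [p ^ #|I|] the sum is the number of [d i] prime to [p], which lies between [1] and
    [#|I|], hence is nonzero and below the modulus. *)
Lemma power_sum_logn_lt (I : finType) (d : I -> nat) (p m : nat) :
  prime p -> (exists i, ~~ (p %| d i)) -> #|I| <= m ->
  totient (p ^ #|I|) %| m -> logn p (\sum_i d i ^ m) < #|I|.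
Proof.
move=> pp [i0 ni0] rm tm.
have r0 : 0 < #|I| by apply/card_gt0P; exists i0.
have S0 : 0 < \sum_i d i ^ m.
  rewrite (bigD1 i0) //= addn_gt0 expn_gt0 lt0n.
  by case: eqP ni0 => // ->; rewrite dvdn0.
rewrite ltnNge -pfactor_dvdn //; apply/negP => dvS.
have eqS : \sum_i d i ^ m = \sum_i (~~ (p %| d i) : nat) %[mod p ^ #|I|].
  elim/big_rec2: _ => // i x y _ IH.
  by rewrite -modnDm IH expn_mod_prime_power // modnDm.
have le : \sum_i (~~ (p %| d i) : nat) <= #|I|.
  by rewrite -sum1_card; apply: leq_sum => i _; case: (~~ _).
have lt := leq_ltn_trans le (ltn_expl #|I| (prime_gt1 pp)).
move/eqP: dvS; rewrite eqS modn_small // (bigD1 i0) //= ni0.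
by [].
Qed.

(* After division by the gcd, exponents divisible by enough totients keep every
   p-adic valuation below the number of terms, so the sums stay bounded. *)
Lemma power_sums_primes_eq (I : finType) (c : I -> nat) (M : nat) :
  0 < M -> (forall i, 0 < c i) ->
  (forall m p, prime p -> p %| \sum_i c i ^ m -> p %| M) ->
  forall i j, c i = c j.
Proof.
move=> M0 c0 hM.
suff [g hg] : exists g, forall i, c i = g by move=> i j; rewrite !hg.
pose g := \big[gcdn/0]_i c i.
have gc i : g %| c i by exact: (biggcdn_inf i).
exists g => i0; pose d i := c i %/ g.
have cd i : c i = d i * g by rewrite divnK.
have g0 : 0 < g by have := c0 i0; rewrite cd muln_gt0 => /andP[].
have d0 i : 0 < d i by have := c0 i; rewrite cd muln_gt0 => /andP[].
suff d1 : d i0 <= 1.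
  by rewrite cd (_ : d i0 = 1) ?mul1n //; apply/eqP; rewrite eqn_leq d1 d0.
rewrite leqNgt; apply/negP => d2.
have nodiv p : prime p -> exists i, ~~ (p %| d i).
  move=> pp; apply/existsP; rewrite -negb_forall; apply/negP => /forallP pd.
  have : p * g %| g.
    by apply/dvdn_biggcdP => i _; rewrite cd dvdn_mul.
  rewrite -{2}[g]mul1n dvdn_pmul2r // dvdn1 => /eqP p1.
  by rewrite p1 in pp.
pose r := #|I|; have r0 : 0 < r by apply/card_gt0P; exists i0.
pose Q := \prod_(p <- primes M) totient (p ^ r).
have Q0 : 0 < Q.
  rewrite /Q big_seq; apply: prodn_cond_gt0 => p.
  by rewrite mem_primes totient_gt0 expn_gt0 => /andP[/prime_gt0 ->].
(* The factor [r * Q] serves the hypotheses of [power_sum_logn_lt]; the factor [M ^ r] makes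
   [d i0 ^ m > m >= M ^ r], which contradicts [dvS]. *)
pose m := M ^ r * (r * Q).
have Mr0 : 0 < M ^ r by rewrite expn_gt0 M0.
have rm : r <= m.
  by rewrite /m mulnCA leq_pmulr // muln_gt0 Mr0.
have S0 : 0 < \sum_i d i ^ m.
  by rewrite (bigD1 i0) //= addn_gt0 expn_gt0 d0.
have dvS : \sum_i d i ^ m %| M ^ r.
  apply/dvdn_partP => // p.
  rewrite mem_primes => /and3P[pp _ pS].
  have pM : p %| M.
    apply: (hM m p pp); rewrite (eq_bigr (fun i => d i ^ m * g ^ m)).
      by rewrite -big_distrl /= dvdn_mulr.
    by move=> i _; rewrite cd expnMn.
  rewrite p_part; apply: dvdn_trans (dvdn_exp2r r pM); apply: dvdn_exp2l.
  apply/ltnW/power_sum_logn_lt => //; first exact: nodiv.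
  rewrite /m 2?dvdn_mull // /Q (bigD1_seq p) /= ?primes_uniq ?dvdn_mulr //.
  by rewrite mem_primes pp M0.
have := dvdn_leq Mr0 dvS; apply/negP; rewrite -ltnNge.
apply: (@leq_trans (d i0 ^ m)); last by rewrite (bigD1 i0) //= leq_addr.
apply: leq_ltn_trans (ltn_expl m d2).
by rewrite /m leq_pmulr // muln_gt0 r0.
Qed.

Local Open Scope classical_set_scope.

(** * Finite cardinalities through ordinals *)

Lemma finite_set_bij_ord (T : Type) :
  finite_set [set: T] -> exists n (f : T -> 'I_n), bijective f.
Proof.
move=> /finite_setP[n /card_set_bijP[f [fun_f inj_f surj_f]]].
have ltf x : f x < n by exact: fun_f.
have preim (i : 'I_n) : exists x, f x = i.
  by have [x _ fx] := surj_f i (ltn_ord i); exists x.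
have [g gK] := choice preim.
exists n, (fun x => Ordinal (ltf x)), g => [x|i]; last exact/val_inj/gK.
by apply: inj_f; rewrite ?in_setE // gK.
Qed.

(** Turns the cardinal equality in [uniform] into counting in ['I_n]. *)
Lemma card_eq_card_pred (T : Type) (n : nat) (f : T -> 'I_n) (g : 'I_n -> T)
    (P : T -> Prop) : cancel f g -> cancel g f ->
  ([set z | P z] #= `I_#|[pred i | `[<P (g i)>]]|)%card.
Proof.
move=> fK gK; pose A := [pred i | `[<P (g i)>]]; apply/card_set_bijP.
have inA z : P z -> f z \in enum A.
  by move=> Pz; rewrite mem_enum inE fK.
exists (fun z => index (f z) (enum A)); rewrite -/A; split.
- by move=> z Pz /=; rewrite cardE index_mem; exact: inA.
- move=> x y; rewrite !in_setE /= => Px Py Exy; apply: (can_inj fK).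
  by rewrite -(nth_index (f x) (inA _ Px)) Exy nth_index ?inA.
- move=> k /=; rewrite cardE => ltk.
  have i0 : 'I_n by case: (enum A) ltk => [|i].
  exists (g (nth i0 (enum A) k)) => /=.
    by have := mem_nth i0 ltk; rewrite mem_enum inE.
  by rewrite gK index_uniq ?enum_uniq.
Qed.

Lemma bij_dep_fun (n : nat) (T : 'I_n -> Type) (c : 'I_n -> nat)
    (f : forall i, T i -> 'I_(c i)) : (forall i, bijective (f i)) ->
  exists h : (forall i, T i) -> {dffun forall i : 'I_n, 'I_(c i)}, bijective h.
Proof.
move=> bf; have inv i : exists g, cancel (f i) g /\ cancel g (f i).
  by have [g fK gK] := bf i; exists g.
have {}inv i := cid (inv i).
exists (fun x => [ffun i => f i (x i)]),
  (fun (y : {dffun forall i : 'I_n, 'I_(c i)}) i => sval (inv i) (y i)).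
- move=> x; apply: functional_extensionality_dep => i.
  by rewrite ffunE; case: (inv i) => g [/= ->].
- move=> y; apply/ffunP => i; rewrite ffunE.
  by case: (inv i) => g [_ /= ->].
Qed.

Lemma prime_dvd_foldr_muln (p : nat) (s : seq nat) :
  prime p -> p %| foldr muln 1 s -> exists2 a, a \in s & p %| a.
Proof.
move=> pp; elim: s => [|a s IH] /=; first by rewrite dvdn1 => /eqP p1; subst.
rewrite Euclid_dvdM // => /orP[pa|/IH[b bs pb]].
  by exists a; rewrite ?mem_head.
by exists b; rewrite // in_cons bs orbT.
Qed.

(** * Subalgebras of finite products of members of [K] *)

Lemma hom_range_subuniverse (S : signature) (A B : algebra S) (f : A -> B) :
  hom f -> subuniverse (range f).
Proof.
move=> hf; split.
  by case: (algebra_inhabited A) => x; exists (f x), x.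
move=> s x rx; have preim i : exists y, f y = x i.
  by have [y _ <-] := rx i; exists y.
have [y hy] := choice preim.
by exists (op y) => //; rewrite hf; congr op; apply: funext.
Qed.

Lemma product_proj_surj (S : signature) (n : nat) (F : 'I_n -> algebra S) i :
  range (fun x : product F => x i) = [set: F i].
Proof.
apply/seteqP; split=> // a _; case: (algebra_inhabited (product F)) => x.
by exists (dfwith x a) => //; rewrite dfwith_in.
Qed.

(** Amounts to an embedding of [T] in a finite product of members of [K], given by coordinate maps
    that may fail to be surjective. *)
Definition separated_by (S : signature) (K : class S) (T : algebra S) : Prop :=
  exists (J : finType) (G : J -> algebra S) (h : forall j, T -> G j),
    [/\ forall j, K (G j), forall j, hom (h j) &
        forall x y, (forall j, h j x = h j y) -> x = y].

(* A minimal separating subfamily embeds T as an irreducible subdirect product. *)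
Lemma surjective_separated_is_product (S : signature) (K : class S)
    (T : algebra S) (J : finType) (G : J -> algebra S) (h : forall j, T -> G j) :
  direct_factor_set K ->
  (forall j, K (G j)) -> (forall j, hom (h j)) ->
  (forall j, range (h j) = [set: G j]) ->
  (forall x y, (forall j, h j x = h j y) -> x = y) ->
  is_product_of K T.
Proof.
move=> [_ dfs] KG homh surjh seph.
pose sep (A : {set J}) := `[<forall x y, (forall j, j \in A -> h j x = h j y) -> x = y>].
have sepT : sep [set: J]%SET.
  by apply/asboolP => x y hxy; apply: seph => j; apply: hxy; rewrite inE.
case: (arg_minnP (fun A : {set J} => #|A|) sepT) => A /asboolP sepA minA.
pose F (i : 'I_#|A|) := G (enum_val i).
pose e (t : T) : product F := fun i => h (enum_val i) t.
have home : hom e.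
  by move=> s x; apply: functional_extensionality_dep => i; rewrite /e homh.
have inje x y : e x = e y -> x = y.
  move=> exy; apply: sepA => j jA.
  rewrite -(enum_rankK_in jA jA).
  exact: (congr1 (fun f : product F => f (enum_rank_in jA j)) exy).
have full : range e = [set: product F].
  apply: dfs => [i||]; first exact: KG.
    split; first exact: hom_range_subuniverse.
    move=> i; apply/seteqP; split=> // a _.
    have : range (h (enum_val i)) a by rewrite surjh.
    by move=> [t _ <-]; exists (e t) => //; exists t.
  move=> I0 [_ nI0]; split.
    by move=> [x y] [/= Bx By ->]; split.
  (* If the kernels indexed by [I0] already meet in the identity, then [I0] yields a separating
     subset of [A]; minimality makes it all of [A], so [I0] is full. *)
  move=> sub; apply: nI0.
  pose A0 : {set J} := [set enum_val i | i : 'I_#|A| & `[<I0 i>]]%SET.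
  have sepA0 : sep A0.
    apply/asboolP => x y hxy; apply: inje.
    have [] // : identity_on (range e) (e x, e y).
    apply: sub; split=> /=; [by exists x|by exists y|].
    move=> i I0i; rewrite /e; apply: hxy; apply/imsetP; exists i => //.
    by rewrite inE; apply/asboolP.
  have := minA _ sepA0; rewrite card_imset; last exact: enum_val_inj.
  rewrite -{1}(card_ord #|A|) => le i _.
  have /eqP E : [set i | `[<I0 i>]]%SET == [set: 'I_#|A|]%SET.
    by rewrite eqEcard finset.subsetT cardsT.
  by have := finset.in_setT i; rewrite -E inE => /asboolP.
exists #|A|, F; split=> [i|]; first exact: KG.
exists e; split=> //.
have surj y : exists x, e x = y.
  by have : range e y by [rewrite full]; move=> [x _ <-]; exists x.
have [g gK] := choice surj.
by exists g => // x; apply: inje; rewrite gK.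
Qed.

(** The image of each separating map is a subalgebra of a member of [K], hence a product; composing
    with the projections of that product gives separating surjections onto members of [K]. *)
Lemma separated_is_product (S : signature) (K : class S) (T : algebra S) :
  direct_factor_set K ->
  (forall (A : algebra S), K A ->
     forall (B : set A) (subB : subuniverse B),
       is_product_of K (subalgebra subB)) ->
  separated_by K T -> is_product_of K T.
Proof.
move=> dfsK subK [J [G [h [KG homh seph]]]].
pose R j := subalgebra (hom_range_subuniverse (homh j)).
have rangeP j : is_product_of K (R j) by exact: subK.
pose n j := sval (cid (rangeP j)).
pose F j : 'I_(n j) -> algebra S := sval (cid (svalP (cid (rangeP j)))).
have FP j : (forall k, K (F j k)) /\ isomorphic (R j) (product (F j)).
  exact: svalP (cid (svalP (cid (rangeP j)))).
pose f j : R j -> product (F j) := sval (cid (FP j).2).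
have [homf bijf] : (forall j, hom (f j)) /\ (forall j, bijective (f j)).
  by split=> j; case: (svalP (cid (FP j).2)).
pose r j t : R j := exist _ (h j t) (imageT (h j) t).
have homr j : hom (r j).
  by move=> s x; apply: eq_exist; rewrite homh.
apply: (@surjective_separated_is_product _ _ _
  {j : J & 'I_(n j)} (fun jk => F (tag jk) (tagged jk))
  (fun jk t => f (tag jk) (r (tag jk) t) (tagged jk))) => //.
- by move=> [j k]; exact: (FP j).1.
- by move=> [j k] s x /=; rewrite homr homf.
- move=> [j k] /=; apply/seteqP; split=> // a _.
  have : range (fun x : product (F j) => x k) a by rewrite product_proj_surj.
  move=> [y _ <-]; have [g fK gK] := bijf j.
  have [t _ ht] := proj2_sig (g y); exists t => //.
  suff -> : r j t = g y by rewrite gK.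
  by case: (g y) ht => b pb /= ht; apply: eq_exist.
- move=> x y hxy; apply: seph => j.
  have : f j (r j x) = f j (r j y).
    by apply: functional_extensionality_dep => k; exact: (hxy (Tagged _ k)).
  by move/(bij_inj (bijf j)) => /(congr1 (@proj1_sig _ _)).
Qed.

(** [M] is the product of the cardinalities in an enumeration of [K]; repeated factors enlarge a
    product but bring in no new prime. *)
Lemma product_card_primes (S : signature) (K : class S) :
  finite_class K -> (forall A, K A -> finite_algebra A) ->
  exists2 M, 0 < M &
    forall T, is_product_of K T ->
      exists n (f : T -> 'I_n),
        bijective f /\ forall p, prime p -> p %| n -> p %| M.
Proof.
move=> [m [G KG]] finK.
have bijG i := cid (finite_set_bij_ord (finK _ ((KG _).2 (ex_intro _ i erefl)))).
pose c i := sval (bijG i).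
have cG i : exists f : G i -> 'I_(c i), bijective f by exact: svalP (bijG i).
have c0 i : 0 < c i.
  have [f _] := cG i; case: (algebra_inhabited (G i)) => x.
  exact: leq_ltn_trans (leq0n _) (ltn_ord (f x)).
exists (\prod_i c i); first by rewrite prodn_gt0.
move=> T [n [F [KF [h [_ bijh]]]]].
have FG i : exists j, F i = G j by apply/KG.
have [a Fa] := choice FG.
have bijF i : exists f : F i -> 'I_(c (a i)), bijective f by rewrite Fa.
have bijF' i := svalP (cid (bijF i)).
have [q bijq] := bij_dep_fun bijF'.
exists #|{dffun forall i : 'I_n, 'I_(c (a i))}|, (enum_rank \o q \o h); split.
  by apply: bij_comp bijh; apply: bij_comp bijq; exact: enum_rank_bij.
move=> p pp; rewrite card_dep_ffun => /(prime_dvd_foldr_muln pp)[b].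
move=> /mapP[i _ ->]; rewrite card_ord => pc.
by rewrite (bigD1 (a i)) //= dvdn_mulr.
Qed.

(** * Tuples inside congruence classes *)

Section CongruencePower.
Variables (S : signature) (T : algebra S) (phi : T -> T -> Prop).
Hypothesis phiP : congruence phi.

(** The index [None] singles out a base point, by which the tuples are later counted. *)
Definition class_power (m : nat) : set (product (fun _ : option 'I_m => T)) :=
  [set x | forall i, phi (x None) (x (Some i))].

Lemma class_power_subuniverse m : subuniverse (@class_power m).
Proof.
split.
  case: (algebra_inhabited T) => t; exists (fun=> t) => i.
  exact: congruence_refl.
by move=> s x Bx i; apply: congruence_op => // j; exact: Bx.
Qed.

(** The maps separating [T], taken at each of the [m + 1] coordinates, separate the tuples. *)
Lemma class_power_separated (K : class S) m :
  separated_by K T -> separated_by K (subalgebra (class_power_subuniverse m)).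
Proof.
move=> [J [G [h [KG homh seph]]]].
exists (option 'I_m * J)%type, (fun oj => G oj.2),
  (fun oj x => h oj.2 (proj1_sig x oj.1)).
split=> [[o j]|[o j] s x|[x Bx] [y By] hxy] //=; first by rewrite homh.
apply: eq_exist; apply: functional_extensionality_dep => o.
by apply: seph => j; exact: (hxy (o, j)).
Qed.

(** Once the base point is fixed, the other [m] entries range freely over its class. *)
Lemma card_class_power (N : nat) (e : 'I_N -> T) m n
    (f : subalgebra (class_power_subuniverse m) -> 'I_n) :
  bijective e -> bijective f ->
  n = \sum_i #|[pred j | `[<phi (e i) (e j)>]]| ^ m.
Proof.
move=> [r eK rK] bijf.
pose A i := [pred j | `[<phi (e i) (e j)>]].
pose P (p : 'I_N * {ffun 'I_m -> 'I_N}) := p.2 \in ffun_on (A p.1).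
transitivity #|[pred p | P p]|; last first.
  rewrite -sum1_card (eq_bigl (fun p => predT p.1 && (p.2 \in ffun_on (A p.1)))) //.
  rewrite -(pair_big_dep predT (fun i g => g \in ffun_on (A i)) (fun _ _ => 1)) /=.
  by apply: eq_bigr => i _; rewrite sum1_card card_ffun_on card_ord.
rewrite -card_sig -[LHS]card_ord.
pose x_ (p : 'I_N * {ffun 'I_m -> 'I_N}) : product (fun _ : option 'I_m => T) :=
  fun o => if o is Some i then e (p.2 i) else e p.1.
have xB (p : {p | P p}) : class_power (x_ (val p)).
  by case: p => [[i g] /= /ffun_onP Pg] k; have := Pg k; rewrite inE.
pose toE (p : {p | P p}) : subalgebra (class_power_subuniverse m) := exist _ _ (xB p).
have bijE : bijective toE.
  pose p_ (x : subalgebra (class_power_subuniverse m)) :=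
    (r (proj1_sig x None), [ffun i => r (proj1_sig x (Some i))]).
  have pP x : P (p_ x).
    apply/ffun_onP => i; rewrite /= ffunE inE /= !rK.
    exact: (proj2_sig x).
  exists (fun x => exist P (p_ x) (pP x)).
    move=> [[i g] Pg]; apply: val_inj => /=; congr pair; first exact: eK.
    by apply/ffunP => k; rewrite ffunE; exact: eK.
  move=> [x Bx]; apply: eq_exist; apply: functional_extensionality_dep.
  by case=> [k|] /=; rewrite ?ffunE rK.
by symmetry; apply: bij_eq_card (bij_comp bijf bijE).
Qed.

End CongruencePower.

Lemma separated_uniform (S : signature) (K : class S) (T : algebra S) :
  finite_class K -> direct_factor_set K ->
  (forall (A : algebra S), K A ->
     forall (B : set A) (subB : subuniverse B),
       is_product_of K (subalgebra subB)) ->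
  separated_by K T ->
  forall (N : nat) (e : 'I_N -> T), bijective e ->
  forall phi : T -> T -> Prop, congruence phi ->
  forall i i', #|[pred j | `[<phi (e i) (e j)>]]| =
               #|[pred j | `[<phi (e i') (e j)>]]|.
Proof.
move=> finK dfsK subK sepT N e bije phi phiP.
have [M M0 HM] := product_card_primes finK dfsK.1.
apply: (@power_sums_primes_eq _ (fun i => #|[pred j | `[<phi (e i) (e j)>]]|) M) => //.
  move=> i; apply/card_gt0P; exists i; rewrite inE.
  exact: congruence_refl.
(* For every [m] the power sum is the size of a product of members of [K], so its primes divide
   [M]. *)
move=> m p pp.
have [n [f [bijf nM]]] := HM _ (separated_is_product dfsK subK
  (class_power_separated phiP m sepT)).
by rewrite -(card_class_power bije bijf); exact: nM.
Qed.

(** * Terms, identities and the relatively free algebra *)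

Inductive term (S : signature) (X : Type) : Type :=
  | Var of X
  | App (s : symbol S) of 'I_(arity s) -> term S X.

Fixpoint eval (S : signature) (X : Type) (A : algebra S) (v : X -> A)
    (t : term S X) : A :=
  match t with
  | Var x => v x
  | App s a => op (fun i => eval v (a i))
  end.

Lemma hom_eval (S : signature) (X : Type) (A B : algebra S) (f : A -> B)
    (v : X -> A) (t : term S X) : hom f -> f (eval v t) = eval (f \o v) t.
Proof.
move=> hf; elim: t => //= s a IH.
by rewrite hf; congr op; apply: funext.
Qed.

Definition models (S : signature) (X : Type) (A : algebra S)
    (s t : term S X) : Prop := forall v : X -> A, eval v s = eval v t.

(** Identities pass to homomorphic images, subalgebras and products; hence the generated variety
    satisfies those of [K]. *)
Lemma variety_models (S : signature) (K : class S) (X : Type) :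
  variety (fun A : algebra S => forall s t : term S X,
    (forall C, K C -> models C s t) -> models A s t).
Proof.
split.
- move=> A B f hf surjf HA s t Kst v.
  have lift x : exists a, f a = v x.
    by have : range f (v x) by [rewrite surjf]; move=> [a _ <-]; exists a.
  have [w fw] := choice lift.
  have -> : v = f \o w by apply: funext => x /=.
  by rewrite -!hom_eval // (HA s t Kst w).
- move=> A B subB HA s t Kst v.
  have homv : hom (fun x : subalgebra subB => proj1_sig x) by [].
  have := HA s t Kst ((fun x : subalgebra subB => proj1_sig x) \o v).
  rewrite -!(hom_eval _ _ homv).
  by case: (eval v s) (eval v t) => [x Bx] [y By] /= xy; exact: eq_exist.
- move=> I F HF s t Kst v; apply: functional_extensionality_dep => i.
  have homi : hom (fun x : product F => x i) by [].
  by rewrite (hom_eval _ s homi) (hom_eval _ t homi); exact: HF.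
Qed.

(* The relatively free algebra on the finite set B embeds in a finite power of
   the members of K, and maps onto B because B satisfies their identities. *)
Lemma finite_variety_quotient_separated (S : signature) (K : class S)
    (B : algebra S) :
  finite_class K -> (forall A, K A -> finite_algebra A) ->
  finite_algebra B -> generated_variety K B ->
  exists (D : algebra S) (q : D -> B),
    [/\ separated_by K D, hom q & range q = [set: B]].
Proof.
move=> [m [G KG]] finK finB genB.
have idB : forall s t : term S B, (forall C, K C -> models C s t) -> models B s t.
  by apply: genB (variety_models K B) _ => A KA s t; exact.
have [b [rB [eB rBK eBK]]] := finite_set_bij_ord finB.
have KGi i : K (G i) by apply/KG; exists i.
have bijG i := cid (finite_set_bij_ord (finK _ (KGi i))).
pose c i := sval (bijG i).
have eG i : exists e : 'I_(c i) -> G i, forall a, exists k, e k = a.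
  have [f [e fK eK]] := svalP (bijG i).
  by exists e => a; exists (f a).
have {}eG i := cid (eG i).
(* The indices represent all valuations of the variables [B] in members of [K], with values coded in
   ['I_(c i)] to make [J] finite. *)
pose J := {i : 'I_m & {ffun 'I_b -> 'I_(c i)}} : finType.
pose val (j : J) (x : B) : G (tag j) := sval (eG (tag j)) (tagged j (rB x)).
have valP i (v : B -> G i) : exists g : {ffun 'I_b -> 'I_(c i)},
    v = val (Tagged (fun i => {ffun 'I_b -> 'I_(c i)}) g).
  have [k hk] := choice (fun a => svalP (eG i) (v (eB a))).
  by exists (finfun k); apply: funext => x; rewrite /val /= ffunE hk rBK.
pose P := product (fun j : J => G (tag j)).
(* [w] collects all valuations at once: terms agree at [w] exactly when [K] satisfies the
   corresponding identity. *)
pose w (x : B) : P := fun j => val j x.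
have subD : subuniverse (range (eval w)).
  split; first by case: (algebra_inhabited B) => x; exists (w x), (Var S x).
  move=> s x rx; have preim i : exists t, eval w t = x i.
    by have [t _ <-] := rx i; exists t.
  have [t ht] := choice preim.
  by exists (App t) => //; apply: (congr1 (@op S P s)); apply: funext.
have eval_eq s t : eval w s = eval w t -> eval (id : B -> B) s = eval id t.
  move=> wst; apply: idB => C /KG[i ->] v.
  have [g ->] := valP i v.
  set j : J := Tagged _ g.
  have homj : hom (fun x : P => x j) by [].
  have := congr1 (fun x : P => x j) wst.
  by rewrite (hom_eval _ s homj) (hom_eval _ t homj).
have pre (d : subalgebra subD) : exists t, eval w t = proj1_sig d.
  by have [t _ ht] := proj2_sig d; exists t.
(* Any term representing [d] would do, since [eval_eq] makes [eval id (tm d)] independent of the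
   choice. *)
have [tm htm] := choice pre.
exists (subalgebra subD), (fun d => eval id (tm d)); split.
- exists J, (fun j => G (tag j)), (fun j d => proj1_sig d j); split=> //.
  move=> [x Bx] [y By] hxy; apply: eq_exist.
  exact: functional_extensionality_dep.
- move=> s x; rewrite -[RHS]/(eval id (App (fun i => tm (x i)))).
  apply: eval_eq; rewrite htm; apply: (congr1 (@op S P s)).
  by apply: funext => i; exact/esym/htm.
- apply/seteqP; split=> // x _.
  exists (exist _ (w x) (imageT (eval w) (Var S x))) => //.
  by rewrite -[RHS]/(eval id (Var S x)); apply: eval_eq; rewrite htm.
Qed.

(** * Passage from [D] to its quotient [B] *)

Lemma congruence_preimage (S : signature) (A B : algebra S) (q : A -> B)
    (theta : B -> B -> Prop) :
  hom q -> congruence theta -> congruence (fun x y => theta (q x) (q y)).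
Proof.
move=> hq [rfl sym trans cop]; split=> [x|x y|x y z|s x y xy].
- exact: rfl.
- exact: sym.
- exact: trans.
- by rewrite !hq; exact: cop.
Qed.

(** Pulled back along a homomorphism, equality becomes its kernel, whose classes are the fibres. *)
Lemma congruence_eq (S : signature) (A : algebra S) : congruence (@eq A).
Proof.
split=> [//|//|x y z -> //|s x y xy].
by congr op; apply: funext.
Qed.

Theorem theorem2p63 (S : signature) (K : class S)
    (finK : finite_class K)
    (dfsK : direct_factor_set K)
    (subK : forall (A : algebra S), K A ->
       forall (B : set A) (subB : subuniverse B),
         is_product_of K (subalgebra subB)) :
  forall B : algebra S,
    finite_algebra B -> generated_variety K B -> has_uniform_congruences B.
Proof.
move=> B finB genB theta thetaP x y.
have [D [q [sepD homq surjq]]] :=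
  finite_variety_quotient_separated finK dfsK.1 finB genB.
have [M _ HM] := product_card_primes finK dfsK.1.
(* [D] is a product of members of [K], hence finite; [e] enumerates it. *)
have [N [r [[e rK eK] _]]] := HM _ (separated_is_product dfsK subK sepD).
have bije : bijective e by exists r.
have [b [rB [eB rBK eBK]]] := finite_set_bij_ord finB.
have unif := separated_uniform finK dfsK subK sepD bije.
have lift z : exists i, q (e i) = z.
  have : range q z by rewrite surjq.
  by move=> [d _ <-]; exists (r d); rewrite rK.
have [i0 qi0] := lift x; have [i1 qi1] := lift y.
pose k := #|[pred j | `[<q (e i0) = q (e j)>]]|.
(* Each class of the pulled back congruence is a union of fibres of q, all of
   size k. *)
have count i : #|[pred j | `[<theta (q (e i)) (q (e j))>]]| =
    #|[pred z | `[<theta (q (e i)) (eB z)>]]| * k.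
  rewrite -sum1_card (partition_big (fun j => rB (q (e j)))
    (fun z => `[<theta (q (e i)) (eB z)>])) /=; last first.
    by move=> j; rewrite rBK.
  rewrite (eq_bigr (fun=> k)); first by rewrite sum_nat_const.
  move=> z thz; have [iz qiz] := lift (eB z).
  rewrite sum1_card /k.
  rewrite (unif _ (congruence_preimage homq (congruence_eq B)) i0 iz).
  apply: eq_card => j; rewrite !inE /= qiz.
  apply/andP/asboolP => [[_ /eqP <-]|zj]; first by rewrite rBK.
  by split; [rewrite inE -zj; exact/asboolP|rewrite -zj eBK].
have k0 : 0 < k by apply/card_gt0P; exists i0; rewrite inE.
apply: card_eq_trans (card_eq_card_pred (theta x) rBK eBK) _.
rewrite card_eq_sym.
apply: card_eq_trans (card_eq_card_pred (theta y) rBK eBK) _.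
(* The pulled back classes have equal size, which is [k] times that of the original classes; [k]
   cancels. *)
have := unif _ (congruence_preimage homq thetaP) i0 i1.
rewrite !count qi0 qi1 => /eqP; rewrite eqn_pmul2r // => /eqP ->.
exact: card_eqxx.
Qed.
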